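(* Let $\mathbb{H}$ be a Hadamard manifold, let $\mathcal{K}\subseteq\mathbb{H}$ be a nonempty geodesic convex set, let $\bar p\in\mathcal{K}$, and let $\Psi=(\Psi_1,\dots,\Psi_m):\mathcal{K}\to\mathbb{R}^m$ be such that each $\Psi_i:\mathcal{K}\to\mathbb{R}$ is locally Lipschitz at $\bar p$ and admits a bounded convexificator $\partial_*^*\Psi_i(\bar p)$, for all $i\in M=\{1,\dots,m\}$. Suppose that $\Psi$ is $\partial_*^*$-convex at $\bar p$ over $\mathcal{K}$. If $\bar p$ is a solution of the Stampacchia $\partial_*^*$-vector variational inequality problem, i.e. for every $q\in\mathcal{K}$ there exists $\xi\in\partial_*^*\Psi(\bar p)$ with $$\langle\xi;\exp_{\bar p}^{-1}q\rangle_m\notin-\mathbb{R}^m_+\setminus\{0\},$$ then $\bar p$ is a minimal point (efficient solution) of the vector optimization problem of minimizing $\Psi$ over $\mathcal{K}$, i.e. $\Psi(q)-\Psi(\bar p)\notin-\mathbb{R}^m_+\setminus\{0\}$ for all $q\in\mathcal{K}$.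
   Context: A Hadamard manifold $\mathbb{H}$ is a complete, simply connected Riemannian manifold of non-positive sectional curvature; $\exp_p:T_p\mathbb{H}\to\mathbb{H}$ is then a diffeomorphism and $t\mapsto\exp_p(t\exp_p^{-1}q)$, $t\in[0,1]$, is the unique minimal geodesic from $p$ to $q$. $\langle\cdot,\cdot\rangle$ is the Riemannian inner product. $\mathcal{K}$ is geodesic convex if $\exp_p(t\exp_p^{-1}q)\in\mathcal{K}$ for all $p,q\in\mathcal{K}$, $t\in[0,1]$. A function is locally Lipschitz at $\bar p$ if it is Lipschitz, with respect to the Riemannian distance, in a neighbourhood of $\bar p$ (in its domain). $\mathbb{R}^m_+$ is the non-negative orthant. For real-valued $f$ on $\mathcal{K}$ and $p\in\mathcal{K}$, the lower/upper Dini derivatives $f^{-}(p;v)$, $f^{+}(p;v)$ are the $\liminf$, $\limsup$ as $t\to0^+$ of $\big(f(\exp_p tv)-f(p)\big)/t$. A closed set $\partial_*^*f(p)\subset T_p\mathbb{H}$ is a convexificator of $f$ at $p$ if for each direction $v\in T_p\mathbb{H}$ (with $\exp_p(tv)\in\mathcal{K}$ for all small $t>0$) both $f^{-}(p;v)\le\sup_{\xi\in\partial_*^*f(p)}\langle\xi,v\rangle$ and $f^{+}(p;v)\ge\inf_{\xi\in\partial_*^*f(p)}\langle\xi,v\rangle$. Convexificators need not be unique; $\partial_*^*\Psi_i(\bar p)$ denotes a fixed one. Put $\partial_*^*\Psi(p)=\partial_*^*\Psi_1(p)\times\dots\times\partial_*^*\Psi_m(p)$; for $\xi=(\xi_1,\dots,\xi_m)$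 with $\xi_i\in T_p\mathbb{H}$ and $v\in T_p\mathbb{H}$, $\langle\xi;v\rangle_m=(\langle\xi_1,v\rangle,\dots,\langle\xi_m,v\rangle)$. For $a,b\in\mathbb{R}^m$, $a\geqq b$ means $a_i\ge b_i$ for all $i$. $\Psi$ is $\partial_*^*$-convex at $\bar p\in\mathcal{K}$ over $\mathcal{K}$ if $\Psi(p)-\Psi(\bar p)\geqq\langle\xi^*;\exp_{\bar p}^{-1}p\rangle_m$ for all $p\in\mathcal{K}$ and all $\xi^*\in\partial_*^*\Psi(\bar p)$. *)

(* Defs.v *)
From HB Require Import structures.
From mathcomp Require Import all_boot all_order all_algebra.
From mathcomp Require Import all_classical all_reals all_analysis.
Set Implicit Arguments.
Unset Strict Implicit.
Unset Printing Implicit Defensive.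
Import Order.TTheory GRing.Theory Num.Theory.
Import numFieldNormedType.Exports.
Local Open Scope classical_set_scope.
Local Open Scope ring_scope.

Section smooth.
Context {R : realType} {n : nat}.

Definition basis_vec (i : 'I_n) : 'rV[R]_n := delta_mx 0 i.

Definition partial (i : 'I_n) (f : 'rV[R]_n -> R) : 'rV[R]_n -> R :=
  fun x => 'D_(basis_vec i) f x.

Fixpoint Ck (k : nat) (U : set 'rV[R]_n) (f : 'rV[R]_n -> R) : Prop :=
  match k with
  | 0%N => forall x, U x -> {for x, continuous f}
  | k'.+1 => forall i, (forall x, U x -> derivable f x (basis_vec i)) /\
                       Ck k' U (partial i f)
  end.

(* Only meaningful for an open set U. *)
Definition smooth (U : set 'rV[R]_n) (f : 'rV[R]_n -> R) : Prop :=
  forall k, Ck k U f.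

Definition smooth_map (m : nat) (U : set 'rV[R]_n)
    (f : 'rV[R]_n -> 'rV[R]_m) : Prop :=
  forall j, smooth U (fun x => f x 0 j).

End smooth.

(* [chart_map] and [chart_inv] are total functions whose values are
   irrelevant outside [chart_dom] and [chart_cod] respectively. *)
Record chart (R : realType) (n : nat) (M : topologicalType) := Chart {
  chart_dom : set M;
  chart_map :> M -> 'rV[R]_n;
  chart_inv : 'rV[R]_n -> M;
  chart_cod := chart_map @` chart_dom;
  chart_dom_open : open chart_dom;
  chart_cod_open : open chart_cod;
  chart_mapK : forall p, chart_dom p -> chart_inv (chart_map p) = p;
  chart_map_continuous :
    forall p, chart_dom p -> {for p, continuous chart_map};
  chart_inv_continuous :
    forall x, chart_cod x -> {for x, continuous chart_inv} }.

Definition overlap (R : realType) (n : nat) (M : topologicalType)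
    (a b : chart R n M) : set 'rV[R]_n :=
  a @` (chart_dom a `&` chart_dom b).

Definition transition (R : realType) (n : nat) (M : topologicalType)
    (a b : chart R n M) : 'rV[R]_n -> 'rV[R]_n :=
  b \o chart_inv a.

(* The atlas need not be maximal.  [chart_at p] is a preferred chart around p;
   it serves to represent tangent vectors at p. *)
Record manifold (R : realType) (n : nat) := Manifold {
  manifold_space :> topologicalType;
  manifold_hausdorff : hausdorff_space manifold_space;
  manifold_second_countable : @second_countable manifold_space;
  atlas : set (chart R n manifold_space);
  chart_at : manifold_space -> chart R n manifold_space;
  chart_at_atlas : forall p, atlas (chart_at p);
  chart_at_dom : forall p, chart_dom (chart_at p) p;
  transition_smooth : forall a b, atlas a -> atlas b ->
    smooth_map (overlap a b) (transition a b) }.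

(* [metric c x] is the Gram matrix (g_ij) of the metric in the chart c, at the
   point with coordinates x.  Vectors are rows, so that ['J f x] acts on
   tangent vectors by right multiplication. *)
Record riemannian (R : realType) (n : nat) := Riemannian {
  riemannian_manifold :> manifold R n;
  metric : chart R n riemannian_manifold -> 'rV[R]_n -> 'M[R]_n;
  metric_smooth : forall c, atlas c -> forall i j,
    smooth (chart_cod c) (fun x => metric c x i j);
  metric_sym : forall c x, atlas c -> chart_cod c x ->
    (metric c x)^T = metric c x;
  metric_pos : forall c x, atlas c -> chart_cod c x ->
    forall v : 'rV[R]_n, v != 0 -> 0 < (v *m metric c x *m v^T) 0 0;
  metric_transition : forall a b x, atlas a -> atlas b -> overlap a b x ->
    metric a x = 'J (transition a b) x *m metric b (transition a b x)
                 *m ('J (transition a b) x)^T }.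

Section geometry.
Context {R : realType} {n : nat} {M : riemannian R n}.
Implicit Types (p q : M) (c : chart R n M) (g : R -> M).

(* A tangent vector at p is the row of its components in [chart_at p]. *)
Definition tangent p : Type := 'rV[R]_n.

Definition inner p (u v : tangent p) : R :=
  (u *m metric (chart_at p) (chart_at p p) *m v^T) 0 0.

Definition velocity g (t : R) : tangent (g t) :=
  derive1 (chart_at (g t) \o g) t.

Definition speed g (t : R) : R :=
  Num.sqrt (inner (velocity g t) (velocity g t)).

Definition C1_curve g : Prop :=
  continuous g /\
  forall c t, atlas c -> chart_dom c (g t) ->
    derivable (c \o g) t 1 /\ {for t, continuous (derive1 (c \o g))}.

Definition curve_length g : R := \int[lebesgue_measure]_(t in `[0, 1]) speed g t.

(* [joined_by p q L]: some piecewise C^1 curve from p to q has length L.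
   Such a curve is a finite concatenation of C^1 pieces, each parametrized by
   [0, 1] (and extended to a C^1 curve on the whole line). *)
Inductive joined_by : M -> M -> R -> Prop :=
| joined_refl p : joined_by p p 0
| joined_step g q L : C1_curve g -> joined_by (g 1) q L ->
    joined_by (g 0) q (curve_length g + L).

Definition rdist p q : R := inf [set L | joined_by p q L].

(* Christoffel symbol Gamma^k_ij of the Levi-Civita connection. *)
Definition christoffel c (k i j : 'I_n) (x : 'rV[R]_n) : R :=
  2^-1 * \sum_(l < n) invmx (metric c x) k l *
    (partial i (fun y => metric c y j l) x +
     partial j (fun y => metric c y i l) x -
     partial l (fun y => metric c y i j) x).

Definition geodesic g : Prop :=
  continuous g /\
  forall c t, atlas c -> chart_dom c (g t) ->
    [/\ derivable (c \o g) t 1,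
        derivable (derive1 (c \o g)) t 1 &
        forall k, derive1n 2 (c \o g) t 0 k +
          \sum_(i < n) \sum_(j < n) christoffel c k i j (c (g t)) *
            derive1 (c \o g) t 0 i * derive1 (c \o g) t 0 j = 0].

Definition geodesic_from p (v : tangent p) g : Prop :=
  [/\ geodesic g, g 0 = p & derive1 (chart_at p \o g) 0 = v].

Definition geodesically_complete : Prop :=
  forall p (v : tangent p), exists g, geodesic_from v g.

(* The default values of [xget] are never reached on a Hadamard manifold. *)
Definition rexp p (v : tangent p) : M :=
  xget p [set g 1 | g in [set g | geodesic_from v g]].
Arguments rexp p v : clear implicits.

Definition rexp_inv p q : tangent p :=
  xget (0 : 'rV[R]_n) [set v : 'rV[R]_n | rexp p v = q].

(* R(d_i, d_j) d_k = \sum_l (riemann c l i j k) d_l, with the convention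
   R(X, Y) Z = nabla_X nabla_Y Z - nabla_Y nabla_X Z - nabla_[X, Y] Z. *)
Definition riemann c (l i j k : 'I_n) (x : 'rV[R]_n) : R :=
  partial i (christoffel c l j k) x - partial j (christoffel c l i k) x +
  \sum_(m < n) (christoffel c l i m x * christoffel c m j k x -
                christoffel c l j m x * christoffel c m i k x).

Definition curvature p (u v w : tangent p) : tangent p :=
  \row_l \sum_(i < n) \sum_(j < n) \sum_(k < n)
    riemann (chart_at p) l i j k (chart_at p p) *
      (u : 'rV[R]_n) 0 i * (v : 'rV[R]_n) 0 j * (w : 'rV[R]_n) 0 k.

Definition sectional p (u v : tangent p) : R :=
  inner (curvature u v v) u / (inner u u * inner v v - inner u v ^+ 2).

Definition nonpositively_curved : Prop :=
  forall p (u v : tangent p),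
    row_free (col_mx (u : 'rV[R]_n) (v : 'rV[R]_n)) -> sectional u v <= 0.

End geometry.
Arguments rexp {R n M} p v.

Definition path_connected (R : realType) (T : topologicalType) : Prop :=
  forall x y : T, exists g : R -> T,
    [/\ {within `[0, 1], continuous g}, g 0 = x & g 1 = y].

Definition null_homotopic (R : realType) (T : topologicalType)
    (g : R -> T) : Prop :=
  exists h : R * R -> T,
    [/\ {within `[0, 1] `*` `[0, 1], continuous h},
        forall t : R, 0 <= t <= 1 -> h (0, t) = g t,
        forall t : R, 0 <= t <= 1 -> h (1, t) = g 0 &
        forall s : R, 0 <= s <= 1 -> h (s, 0) = g 0 /\ h (s, 1) = g 0].

Definition simply_connected (R : realType) (T : topologicalType) : Prop :=
  path_connected R T /\
  forall g : R -> T, {within `[0, 1], continuous g} -> g 0 = g 1 ->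
    null_homotopic g.

Definition hadamard (R : realType) (n : nat) (H : riemannian R n) : Prop :=
  [/\ geodesically_complete (M := H), simply_connected R H &
      nonpositively_curved (M := H)].

Section optimization.
Context {R : realType} {n : nat} {H : riemannian R n}.
Implicit Types (K : set H) (p q : H) (f : H -> R).

Definition geodesic_convex K : Prop :=
  forall p q (t : R), K p -> K q -> 0 <= t <= 1 ->
    K (rexp p (t *: rexp_inv p q)).

(* A function on K is a total function whose values outside K are never used. *)
Definition locally_lipschitz_at K f p : Prop :=
  exists (U : set H) (L : R), nbhs p U /\
    forall x y, (K `&` U) x -> (K `&` U) y ->
      `|f x - f y| <= L * rdist x y.

Definition dini_lower f p (v : tangent p) : \bar R :=
  limf_einf (fun t : R => ((f (rexp p (t *: v)) - f p) / t)%:E) 0^'+.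

Definition dini_upper f p (v : tangent p) : \bar R :=
  limf_esup (fun t : R => ((f (rexp p (t *: v)) - f p) / t)%:E) 0^'+.

Definition convexificator K f p (C : set (tangent p)) : Prop :=
  closed (C : set 'rV[R]_n) /\
  forall v : tangent p, (\forall t \near 0^'+, K (rexp p (t *: v))) ->
    (dini_lower f v <= ereal_sup [set (inner xi v)%:E | xi in C])%E /\
    (ereal_inf [set (inner xi v)%:E | xi in C] <= dini_upper f v)%E.

Definition bounded_tangent p (C : set (tangent p)) : Prop :=
  exists B : R, forall xi, C xi -> Num.sqrt (inner xi xi) <= B.

Context {m : nat}.
Implicit Types (Psi : H -> 'rV[R]_m).

Definition prod_set p (C : 'I_m -> set (tangent p)) : set ('I_m -> tangent p) :=
  [set xi | forall i, C i (xi i)].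

Definition inner_vec p (xi : 'I_m -> tangent p) (v : tangent p) : 'rV[R]_m :=
  \row_i inner (xi i) v.

Definition vec_ge (a b : 'rV[R]_m) : Prop := forall i, a 0 i >= b 0 i.

Definition orthant : set 'rV[R]_m := [set y | forall i, 0 <= y 0 i].

Definition neg_orthant_minus0 : set 'rV[R]_m :=
  [set - y | y in orthant] `\ (0 : 'rV[R]_m).

(* [C i] is the fixed convexificator of the i-th component at p. *)
Definition convexificator_convex K Psi p (C : 'I_m -> set (tangent p)) : Prop :=
  forall q, K q -> forall xi, prod_set C xi ->
    vec_ge (Psi q - Psi p) (inner_vec xi (rexp_inv p q)).

Definition stampacchia_solution K p (C : 'I_m -> set (tangent p)) : Prop :=
  forall q, K q -> exists xi, prod_set C xi /\
    ~ neg_orthant_minus0 (inner_vec xi (rexp_inv p q)).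

Definition efficient K Psi p : Prop :=
  forall q, K q -> ~ neg_orthant_minus0 (Psi q - Psi p).

End optimization.

(* Main.v *)
Require Import Defs.
From mathcomp Require Import all_boot all_order all_algebra.
From mathcomp Require Import all_classical all_reals all_analysis.
Import Order.TTheory GRing.Theory Num.Theory.
Import numFieldNormedType.Exports.
Local Open Scope classical_set_scope.
Local Open Scope ring_scope.

(** If some [q] dominated [pbar], convexity would place the inner products of every [xi] with
    [rexp_inv pbar q] below [Psi q - Psi pbar], which is nonpositive and nonzero. They would then be
    nonpositive and nonzero too, contradicting the [xi] that the variational inequality supplies for
    [q]. *)

Theorem theorem4p4 (R : realType) (n m : nat) (H : riemannian R n)
    (hadamardH : hadamard H)
    (K : set H) (K_nonempty : K !=set0) (K_convex : geodesic_convex K)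
    (pbar : H) (K_pbar : K pbar)
    (Psi : H -> 'rV[R]_m) (dPsi : 'I_m -> set (tangent pbar))
    (Psi_lipschitz : forall i : 'I_m,
       locally_lipschitz_at K (fun p => Psi p 0 i) pbar)
    (dPsi_convexificator : forall i : 'I_m,
       convexificator K (fun p => Psi p 0 i) (dPsi i))
    (dPsi_bounded : forall i : 'I_m, bounded_tangent (dPsi i))
    (Psi_convex : convexificator_convex K Psi dPsi)
    (pbar_solution : stampacchia_solution K dPsi) :
  efficient K Psi pbar.
Proof.
move=> q Kq [[y y_ge0 yE] dPsi_neq0].
have dPsi_le0 i : (Psi q - Psi pbar) 0 i <= 0.
  by rewrite -yE mxE oppr_le0 y_ge0.
have [xi [Cxi xi_notin]] := pbar_solution q Kq.
have xi_le := Psi_convex q Kq xi Cxi.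
apply: xi_notin; split.
  (* Each inner product is at most 0 by transitivity through [Psi q - Psi pbar]. *)
  exists (- inner_vec xi (rexp_inv pbar q)); last by rewrite opprK.
  by move=> i; rewrite mxE oppr_ge0 (le_trans (xi_le i)).
(* If the vector of inner products vanished, convexity would force
   [Psi q - Psi pbar] to be both nonnegative and nonpositive. *)
move=> /= xi0; apply: dPsi_neq0; apply/rowP => i.
apply/eqP; rewrite [X in _ == X]mxE eq_le dPsi_le0 /=.
by have := xi_le i; rewrite xi0 [X in X <= _]mxE.
Qed.
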